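(* Suppose that the components of $T$ are affine independent on $\mathrm{supp}\, f$, i.e. for every $(0,0)\neq(\lambda,\mu)\in\mathbb{R}^L\times\mathbb{R}$ there exists $x\in\mathrm{supp}\, f$ with $\langle\lambda,T(x)\rangle+\mu\neq 0$, and that $\bar T\in\mathrm{int}(\mathrm{co}\,T(D_M))$ for every $M$. Suppose also that $\lim_{M\to\infty}\sum_{i=1}^{I_M}q_{i,M}h(x_{i,M})=\int_{\mathbb{R}^K}f(x)h(x)\,dx$ for every bounded continuous $h:\mathbb{R}^K\to\mathbb{R}$, and that $\lim_{M\to\infty}\sum_{i=1}^{I_M}q_{i,M}T(x_{i,M})=\int_{\mathbb{R}^K}f(x)T(x)\,dx$. Then for any bounded continuous function $g:\mathbb{R}^K\to\mathbb{R}$, $$\lim_{M\to\infty}\sum_{i=1}^{I_M}p_{i,M}g(x_{i,M})=\int_{\mathbb{R}^K}f(x)g(x)\,dx,$$ i.e. the discrete distribution $P_M$ weakly converges to the distribution with density $f$.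
   Context: $f$ is a probability density on $\mathbb{R}^K$ and $\mathrm{supp}\, f$ is its support (the support of the measure $f(x)\,dx$). $T:\mathbb{R}^K\to\mathbb{R}^L$ is continuous, with finite moment $\bar T=\int_{\mathbb{R}^K}f(x)T(x)\,dx$. For each positive integer $M$, $D_M=\{x_{i,M}\mid i=1,\dots,I_M\}\subset\mathbb{R}^K$ is a given finite set of $I_M$ points, and $Q_M=\{q_{i,M}\}_{i=1}^{I_M}$ is a given probability distribution on $D_M$, with $q_{i,M}>0$ and $\sum_{i=1}^{I_M}q_{i,M}=1$. $\mathrm{co}\,T(D_M)$ is the convex hull of $\{T(x_{i,M})\}_{i=1}^{I_M}$ and $\mathrm{int}$ is the interior in $\mathbb{R}^L$. $\langle\cdot,\cdot\rangle$ is the usual inner product on $\mathbb{R}^L$. When $\bar T\in\mathrm{int}(\mathrm{co}\,T(D_M))$, let $\lambda_M\in\mathbb{R}^L$ be the (unique) maximizer over $\lambda\in\mathbb{R}^L$ of $\langle\lambda,\bar T\rangle-\log\left(\sum_{i=1}^{I_M}q_{i,M}e^{\langle\lambda,T(x_{i,M})\rangle}\right)$, and define the probability distribution $P_M=\{p_{i,M}\}$ on $D_M$ by $$p_{i,M}=\frac{q_{i,M}e^{\langle\lambda_M,T(x_{i,M})\rangle}}{\sum_{j=1}^{I_M}q_{j,M}e^{\langle\lambda_M,T(x_{j,M})\rangle}}.$$ (Equivalently, $P_M$ is the unique minimizer of $\sum_i p_i\log(p_i/q_{i,M})$ subject to $\sum_i p_iT(x_{i,M})=\bar T$, $\sum_i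 p_i=1$, $p_i\ge0$, with $0\log 0=0$.) *)

(* Defs.v *)
From HB Require Import structures.
From mathcomp Require Import all_boot all_order all_algebra.
From mathcomp Require Import all_classical all_reals all_analysis.
From mathcomp Require Import measurable_realfun.

Set Implicit Arguments.
Unset Strict Implicit.
Unset Printing Implicit Defensive.

Import Order.TTheory GRing.Theory Num.Theory.
Import numFieldNormedType.Exports.

Local Open Scope classical_set_scope.
Local Open Scope ring_scope.

(* Row vectors carry the product sigma-algebra, generated by the coordinate
   maps; over a realType it is the Borel one, see measurable_rV_borel. *)
Definition measure_rV_display : measure_display -> measure_display.
Proof. exact. Qed.

Section measurable_rV.
Context d (T : measurableType d) (n : nat).

Let coors : 'I_n -> 'rV[T]_n -> T := fun i x => x ord0 i.

Let rV_set0 : g_sigma_preimage coors set0.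
Proof. exact: sigma_algebra0. Qed.

Let rV_setC A : g_sigma_preimage coors A -> g_sigma_preimage coors (~` A).
Proof. exact: sigma_algebraC. Qed.

Let rV_bigcup (F : (set 'rV[T]_n)^nat) :
  (forall i, g_sigma_preimage coors (F i)) ->
  g_sigma_preimage coors (\bigcup_i F i).
Proof. exact: sigma_algebra_bigcup. Qed.

HB.instance Definition _ := @isMeasurable.Build (measure_rV_display d)
  'rV[T]_n (g_sigma_preimage coors) rV_set0 rV_setC rV_bigcup.

Lemma measurable_coord (i : 'I_n) :
  measurable_fun [set: 'rV[T]_n] (fun x : 'rV[T]_n => x ord0 i).
Proof.
move=> _ Y mY; rewrite setTI; apply: sub_sigma_algebra => /=.
rewrite -bigcup_seq/=; exists i => /=; first by rewrite mem_index_enum.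
by exists Y => //; rewrite setTI.
Qed.

End measurable_rV.

Lemma measurable_fun_coordP d1 d2 (T1 : measurableType d1)
    (T2 : measurableType d2) n (f : T1 -> 'rV[T2]_n) :
  (forall i, measurable_fun setT (fun x => f x ord0 i)) ->
  measurable_fun setT f.
Proof.
move=> mf.
suff H : g_sigma_preimage (fun i x => f x ord0 i) `<=` measurable.
  move=> _ A mA; rewrite setTI; apply: H.
  rewrite (_ : (fun i x => _) =
               (fun i => (fun v : 'rV[T2]_n => v ord0 i) \o f)) //.
  rewrite g_sigma_preimage_comp.
  by exists A => //; rewrite setTI.
apply: smallest_sub; first exact: sigma_algebra_measurable.
rewrite -bigcup_seq/=; apply: bigcup_sub => i _ A [B mB <-].
exact: mf.
Qed.


Lemma measurable_box d (T : measurableType d) n (A : 'I_n -> set T) :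
  (forall i, measurable (A i)) ->
  measurable [set x : 'rV[T]_n | forall i, A i (x ord0 i)].
Proof.
move=> mA.
rewrite (_ : mkset _ =
  \bigcap_(i in [set: 'I_n]) ((fun x : 'rV[T]_n => x ord0 i) @^-1` A i)).
  apply: fin_bigcap_measurable => //= i _.
  by rewrite -[X in measurable X]setTI; exact: measurable_coord.
by apply/seteqP; split=> [x xA i _|x xA i]; [exact: xA|exact: xA].
Qed.

Lemma measurable_rV_borel (R : realType) n :
  @measurable _ 'rV[R]_n = <<s [set U : set 'rV[R]_n | open U] >>.
Proof.
apply/seteqP; split; last first.
  apply: smallest_sub; first exact: sigma_algebra_measurable.
  move=> U /= oU.
  pose B (p : 'rV[rat]_n * nat) :=
    ball (map_mx ratr p.1 : 'rV[R]_n) (p.2.+1%:R^-1 : R).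
  rewrite (_ : U = \bigcup_(p in [set p | B p `<=` U]) B p).
    rewrite bigcup_mkcond; apply: (@countable_bigcupT_measurable _ 'rV[R]_n _ _) => [|p].
      exact: countableP.
    case: ifPn => // _.
    rewrite (_ : B p = [set x : 'rV[R]_n | forall i,
        ball (ratr (p.1 ord0 i) : R) (p.2.+1%:R^-1) (x ord0 i)]).
      apply: (@measurable_box _ R n
        (fun i => ball (ratr (p.1 ord0 i) : R) p.2.+1%:R^-1)) => i.
      exact: measurable_ball.
    apply/seteqP; split=> x /=.
      by move=> [_ /(_ ord0)] + i => /(_ i); rewrite mxE.
    by move=> xb; split=> // i j; rewrite ord1 mxE.
  apply/seteqP; split=> [x Ux|x [p /= pU]]; last exact: pU.
  have /nbhs_ballP[e /= e0 eU] : nbhs x U by exact: open_nbhs_nbhs.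
  have [k _ ke] : \forall k \near \oo, (k.+1%:R^-1 : R) < e / 2.
    by apply: near_infty_natSinv_lt (PosNum (divr_gt0 e0 _)).
  have {}ke := ke _ (leqnn k).
  have k0 : 0 < k.+1%:R^-1 :> R by rewrite invr_gt0.
  have /choice[q xq] (i : 'I_n) : exists q : rat,
      ball (x ord0 i) (k.+1%:R^-1) (ratr q : R).
    have [r [xr [q _ qr]]] := dense_rat
      (ex_intro _ _ (ballxx (x ord0 i) k0)) (ball_open (x ord0 i) _).
    by exists q; rewrite qr.
  exists (\row_i q i, k) => /=.
    move=> y [_ yB]; apply: eU; split=> // i j; rewrite ord1.
    apply: (@le_ball _ _ _ (k.+1%:R^-1 + k.+1%:R^-1)).
      by rewrite [leRHS]splitr lerD// ltW.
    by apply: ball_triangle (xq j) _; have := yB ord0 j; rewrite !mxE.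
  by split=> // i j; rewrite ord1 !mxE; apply/ball_sym.
apply: smallest_sub; first exact: smallest_sigma_algebra.
rewrite -bigcup_seq/=; apply: bigcup_sub => i _ A [C mC <-].
pose S := g_sigma_algebraType [set U : set 'rV[R]_n | open U].
suff : measurable_fun [set: S] (fun x : S => (x : 'rV[R]_n) ord0 i).
  by move=> /(_ measurableT _ mC).
apply: (measurability _ (RGenOpens.measurableE R)).
move=> _ [_ [a [b ->]] <-]; rewrite setTI; apply: sub_sigma_algebra => /=.
by apply: open_comp => //; move=> x _; exact: coord_continuous.
Qed.

Section lebesgue_measure_rV.
Variable R : realType.

Definition row_cons n (p : measurableTypeR R * 'rV[R]_n) : 'rV[R]_n.+1 :=
  row_mx (const_mx p.1 : 'rV_1) p.2.

Lemma row_cons0 n (p : measurableTypeR R * 'rV[R]_n) : row_cons p ord0 ord0 = p.1.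
Proof.
transitivity ((const_mx p.1 : 'rV_1) ord0 ord0); last by rewrite mxE.
rewrite -[RHS](row_mxEl _ p.2 ord0 ord0).
have E : ord0 = @lshift 1 n ord0 :> 'I_n.+1 by exact: val_inj.
exact: (congr1 (row_cons p ord0) E).
Qed.

Lemma row_consS n (p : measurableTypeR R * 'rV[R]_n) j :
  row_cons p ord0 (lift ord0 j) = p.2 ord0 j.
Proof.
rewrite -(row_mxEr (const_mx p.1 : 'rV_1) p.2 ord0 j).
have E : lift ord0 j = @rshift 1 n j :> 'I_n.+1 by exact: val_inj.
exact: (congr1 (row_cons p ord0) E).
Qed.

Lemma measurable_row_cons n : measurable_fun setT (@row_cons n).
Proof.
apply: measurable_fun_coordP => i; case: (unliftP ord0 i) => [j ->|->].
  under eq_fun do rewrite row_consS.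
  exact: measurableT_comp (@measurable_coord _ R n j) measurable_snd.
under eq_fun do rewrite row_cons0.
exact: measurable_fst.
Qed.

Definition lebesgue_cons n (mu : set 'rV[R]_n -> \bar R) :
    set 'rV[R]_n.+1 -> \bar R :=
  pushforward (lebesgue_measure \x^ mu)%E (@row_cons n).

Section lebesgue_cons_measure.
Variables (n : nat) (mu : {measure set 'rV[R]_n -> \bar R}).

Let nu := measure_function_pushforward__canonical__measure_function_Measure
  (lebesgue_measure \x^ mu)%E (@measurable_row_cons n).

HB.instance Definition _ := isMeasure.Build _ _ _ (lebesgue_cons mu)
  (measure0 nu) (measure_ge0 nu) (@measure_semi_sigma_additive _ _ _ nu).

End lebesgue_cons_measure.

(* Iterated product of the Lebesgue measure on R; see lebesgue_rV_box. *)
Fixpoint lebesgue_rV n : {measure set 'rV[R]_n -> \bar R} :=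
  match n with
  | 0 => dirac (0 : 'rV[R]_0)
  | m.+1 => lebesgue_cons (lebesgue_rV m)
  end.

Lemma lebesgue_rV_box n (A : 'I_n -> set R) : (forall i, measurable (A i)) ->
  lebesgue_rV n [set x | forall i, A i (x ord0 i)] =
  (\prod_(i < n) lebesgue_measure (A i))%E.
Proof.
elim: n => [|n IHn] in A *; move=> mA.
  rewrite big_ord0 /= diracE mem_set//.
  by move=> [].
rewrite big_ord_recl -IHn//.
rewrite -product_measure2E; first last.
- exact: (measurable_box (fun i => mA (lift ord0 i))).
- exact: mA.
rewrite /= /lebesgue_cons /pushforward; congr (product_measure2 _ _ _).
apply/seteqP; split=> [p pA|p [p1 p2] i] /=.
  split; first by have := pA ord0; rewrite row_cons0.
  by move=> i; have := pA (lift ord0 i); rewrite row_consS.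
by case: (unliftP ord0 i) => [j ->|->]; rewrite ?row_consS ?row_cons0.
Qed.

End lebesgue_measure_rV.

Section definitions.
Variable R : realType.

Definition dotv n (u v : 'rV[R]_n) : R := \sum_(j < n) u ord0 j * v ord0 j.

Definition convex_hull (E : lmodType R) (A : set E) : set E :=
  smallest (@convex_set R E) A.

Definition probability_density K (f : 'rV[R]_K -> R) : Prop :=
  [/\ measurable_fun setT f, (forall x, 0 <= f x) &
      (\int[lebesgue_rV R K]_x (f x)%:E = 1)%E].

Definition density_measure K (f : 'rV[R]_K -> R) (A : set 'rV[R]_K) : \bar R :=
  (\int[lebesgue_rV R K]_(x in A) (f x)%:E)%E.

Definition support_of (T : topologicalType) (mu : set T -> \bar R) : set T :=
  [set x | forall U, open U -> U x -> (0 < mu U)%E].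

Definition density_mean K (f h : 'rV[R]_K -> R) : R :=
  \int[lebesgue_rV R K]_x (f x * h x).

Definition finite_moment K L (f : 'rV[R]_K -> R) (T : 'rV[R]_K -> 'rV[R]_L) :=
  forall j, (lebesgue_rV R K).-integrable setT
              (fun x => (f x * T x ord0 j)%:E).

Definition moment K L (f : 'rV[R]_K -> R) (T : 'rV[R]_K -> 'rV[R]_L) :
    'rV[R]_L :=
  \row_j density_mean f (fun x => T x ord0 j).

(* Affine independence of the components of T as functions on S. *)
Definition affine_independent_on K L (T : 'rV[R]_K -> 'rV[R]_L)
    (S : set 'rV[R]_K) : Prop :=
  forall (l : 'rV[R]_L) (m : R), (l, m) <> (0, 0) ->
    exists2 x, S x & dotv l (T x) + m <> 0.

Section dual.
Variables (K L n : nat) (T : 'rV[R]_K -> 'rV[R]_L) (Tbar : 'rV[R]_L).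
Variables (x : 'I_n -> 'rV[R]_K) (q : 'I_n -> R).

Definition partition_fun (l : 'rV[R]_L) : R :=
  \sum_(i < n) q i * expR (dotv l (T (x i))).

Definition dual_objective (l : 'rV[R]_L) : R :=
  dotv l Tbar - ln (partition_fun l).

(* [get] is a choice operator: when Tbar is interior to the convex hull of the
   T (x i), the maximizer exists and, the objective being strictly concave, is
   unique. *)
Definition dual_maximizer : 'rV[R]_L :=
  get [set l | forall l', dual_objective l' <= dual_objective l].

Definition maxent_weight (i : 'I_n) : R :=
  q i * expR (dotv dual_maximizer (T (x i))) / partition_fun dual_maximizer.

End dual.

End definitions.

(* Main.v *)
Require Import Defs.
From mathcomp Require Import all_boot all_order all_algebra.
From mathcomp Require Import all_classical all_reals all_analysis.
From mathcomp Require Import measurable_realfun ring lra.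

Set Implicit Arguments.
Unset Strict Implicit.
Unset Printing Implicit Defensive.

Import Order.TTheory GRing.Theory Num.Theory.
Import numFieldNormedType.Exports.

Local Open Scope classical_set_scope.
Local Open Scope ring_scope.

(** Write [S = T - c], where [c] is the moment of [T] under [f], and
    [Z l = \sum_i q_i exp <l, S x_i>], so that [Z 0 = 1] and the dual objective
    is [- ln Z].  The maximizer [l] minimizes the convex function [Z]; in
    particular [Z l <= 1].

    The key point is that [P_M] is controlled by the relative entropy of [Q_M]
    with respect to [P_M], not the other way round.  As [ln Z l <= 0],

      [KL(Q | P) = ln Z l - <l, \sum_i q_i S x_i>
                 <= L * |l| * |\sum_i q_i S x_i|]

    where the factor [L] comes from the use of the sup norm, and the last factor
    tends to 0 by assumption.  So it is enough that [l] remains bounded: then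
    [KL(Q | P)] tends to 0, a Pinsker-type inequality ([tilt_l1_le]) makes the
    total variation distance between [P_M] and [Q_M] tend to 0, and [P_M]
    inherits the weak limit of [Q_M].

    To bound [l], it is shown that for large [M] one has [1 < Z] on the whole
    unit sphere ([partition_fun_gt1_on_sphere]).  Since [Z 0 = 1] and [Z] is
    convex, [1 < Z] then holds outside the open unit ball; hence a minimizer of
    [Z] exists, and it has norm less than 1 ([dual_maximizer_small]).  For [u]
    on the sphere,

      [Z u = 1 + <u, \sum_i q_i S x_i> + \sum_i q_i phi <u, S x_i>]

    with [phi s = exp s - 1 - s], which is positive except at 0.  The linear
    term tends to 0.  Affine independence yields a point of the support of [f]
    at which [<u, S>] does not vanish; near this point, and for all directions
    close to [u], [phi <u, S>] is bounded below by a positive constant, so by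
    weak convergence the last sum stays away from 0.  Compactness of the sphere makes this uniform. *)

(** * The inner product and the unit ball *)

Lemma continuous_sum (R : realType) (S : topologicalType) m
    (F : 'I_m -> S -> R) :
  (forall i, continuous (F i)) -> continuous (fun s => \sum_(i < m) F i s).
Proof.
move=> cF s; apply: cvg_big => [|i _]; first exact: add_continuous.
exact: cF.
Qed.

Section dotv_theory.
Variables (R : realType) (n : nat).
Implicit Types u v w : 'rV[R]_n.

Lemma dotv0l v : dotv 0 v = 0.
Proof. by rewrite /dotv big1// => j _; rewrite mxE mul0r. Qed.

Lemma dotvZl a u v : dotv (a *: u) v = a * dotv u v.
Proof.
by rewrite /dotv mulr_sumr; apply: eq_bigr => j _; rewrite mxE mulrA.
Qed.

Lemma dotvBr u v w : dotv u (v - w) = dotv u v - dotv u w.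
Proof.
by rewrite /dotv -sumrB; apply: eq_bigr => j _; rewrite !mxE mulrBr.
Qed.

Lemma dotv_sumr u m (c : 'I_m -> R) (V : 'I_m -> 'rV[R]_n) :
  dotv u (\sum_(i < m) c i *: V i) = \sum_(i < m) c i * dotv u (V i).
Proof.
rewrite /dotv; under eq_bigr do rewrite summxE mulr_sumr.
rewrite exchange_big; apply: eq_bigr => i _.
by rewrite mulr_sumr; apply: eq_bigr => j _; rewrite mxE mulrCA.
Qed.

Lemma norm_coord_le v j : `|v ord0 j| <= `|v|.
Proof.
rewrite [leRHS]/Num.norm /= mx_normrE; apply/bigmax_geP; right => /=.
by exists (ord0, j).
Qed.

Lemma norm_dotv_le u v : `|dotv u v| <= n%:R * `|u| * `|v|.
Proof.
rewrite (le_trans (ler_norm_sum _ _ _))//.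
rewrite -mulrA mulr_natl -[X in _ *+ X]card_ord -sumr_const.
by apply: ler_sum => j _; rewrite normrM ler_pM// norm_coord_le.
Qed.

Lemma continuous_dotv :
  continuous (fun p : 'rV[R]_n * 'rV[R]_n => dotv p.1 p.2).
Proof.
apply: continuous_sum => j p.
apply: cvgM.
  apply: (@cvg_comp _ _ _ fst (fun u : 'rV[R]_n => u ord0 j)).
    exact: cvg_fst.
  exact: coord_continuous.
apply: (@cvg_comp _ _ _ snd (fun u : 'rV[R]_n => u ord0 j)).
  exact: cvg_snd.
exact: coord_continuous.
Qed.

Lemma continuous_dotvl v : continuous (fun u => dotv u v).
Proof.
apply: continuous_sum => j u.
apply: (@continuousM _ _ (fun u : 'rV[R]_n => u ord0 j) (fun=> v ord0 j)).
  exact: coord_continuous.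
exact: cst_continuous.
Qed.

End dotv_theory.

Lemma closed_unit_ball_compact (R : realType) n :
  compact [set u : 'rV[R]_n | `|u| <= 1].
Proof.
apply: bounded_closed_compact.
  by exists 1; split=> // M M1 u /= u1; rewrite (le_trans u1)// ltW.
rewrite (_ : mkset _ = Num.norm @^-1` [set r : R | r <= 1])//.
apply: closed_comp => [u _|]; [exact: norm_continuous|exact: closed_le].
Qed.

Lemma unit_sphere_compact (R : realType) n :
  compact [set u : 'rV[R]_n | `|u| = 1].
Proof.
apply: (subclosed_compact _ (@closed_unit_ball_compact R n)).
  rewrite (_ : mkset _ = Num.norm @^-1` [set 1 : R])//.
  apply: closed_comp => [u _|]; [exact: norm_continuous|exact: closed_eq].
by move=> u /= ->.
Qed.

(** * Total variation and relative entropy *)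

(** A Pinsker-type inequality.  Here [t] is the log-density of a second
    probability with respect to [q], the left-hand side of the conclusion is
    the total variation norm of the difference, and [- \sum_i q i * t i] is the
    relative entropy.  With [u = exp (t / 2)], the factorization
    [|u ^+ 2 - 1| = |u - 1| * (u + 1)] and the inequality between the arithmetic
    and geometric means bound the total variation by [a] plus [a^-1] times the
    squared Hellinger distance [\sum_i q i * (u i - 1) ^+ 2], which is at most
    the relative entropy since [1 + t / 2 <= u]. *)
Lemma tilt_l1_le (R : realType) n (q t : 'I_n -> R) (a : R) :
  (forall i, 0 <= q i) -> \sum_i q i = 1 -> \sum_i q i * expR (t i) = 1 ->
  0 < a -> - \sum_i q i * t i <= a ^+ 2 ->
  \sum_i q i * `|expR (t i) - 1| <= 2 * a.
Proof.
move=> q0 q1 qe1 a0 qt.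
pose u i := expR (t i / 2).
have u2 i : expR (t i) = u i ^+ 2.
  by rewrite /u expr2 -expRD -splitr.
have pt i : `|expR (t i) - 1| <=
    a^-1 * (u i ^+ 2 + 1 - 2 * u i) + a / 2 * (u i ^+ 2 + 1).
  have u0 : 0 < u i := expR_gt0 _.
  have e : expR (t i) - 1 = (u i - 1) * (u i + 1) by rewrite u2; ring.
  rewrite e normrM (ger0_norm (_ : 0 <= u i + 1)); last by lra.
  (* the weight a in the mean inequality will balance the two error terms *)
  have : 0 <= a^-1 * (`|u i - 1| - a / 2 * (u i + 1)) ^+ 2.
    by rewrite mulr_ge0 ?sqr_ge0// invr_ge0 ltW.
  have -> : a^-1 * (`|u i - 1| - a / 2 * (u i + 1)) ^+ 2 =
     a^-1 * `|u i - 1| ^+ 2 - `|u i - 1| * (u i + 1) + a / 4 * (u i + 1) ^+ 2.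
    by field; rewrite gt_eqF.
  rewrite real_normK ?num_real//.
  have : 0 <= a / 4 * (u i - 1) ^+ 2.
    by rewrite mulr_ge0 ?sqr_ge0// divr_ge0// ltW.
  nra.
have qu i : q i * (u i ^+ 2 + 1 - 2 * u i) <=
    q i * expR (t i) - q i - q i * t i.
  have : 1 + t i / 2 <= u i := expR_ge1Dx _.
  rewrite u2; have := q0 i; nra.
rewrite (@le_trans _ _ (\sum_i (a^-1 * (q i * expR (t i) - q i - q i * t i)
    + a / 2 * (q i * expR (t i) + q i))))//.
  apply: ler_sum => i _; apply: le_trans (ler_wpM2l (q0 i) (pt i)) _.
  rewrite mulrDr lerD//; first by rewrite mulrCA ler_wpM2l// invr_ge0 ltW.
  by rewrite u2; lra.
rewrite big_split/= -!mulr_sumr !big_split/= !sumrN qe1 q1.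
have : a^-1 * (- \sum_i q i * t i) <= a.
  by rewrite ler_pdivrMl// -expr2.
lra.
Qed.

(** * The dual problem *)

Section partition.
Variables (R : realType) (K L n : nat).
Variables (T : 'rV[R]_K -> 'rV[R]_L) (x : 'I_n -> 'rV[R]_K) (q : 'I_n -> R).
Hypotheses (q0 : forall i, 0 < q i) (q1 : \sum_i q i = 1).

Lemma partition_fun_gt0 l : 0 < partition_fun T x q l.
Proof.
case: n x q q0 q1 => [|m] y p p0 p1.
  by move: p1; rewrite big_ord0 => /esym/eqP; rewrite oner_eq0.
rewrite /partition_fun big_ord_recl ltr_wpDr//; last first.
  by rewrite mulr_gt0// expR_gt0.
by apply: sumr_ge0 => i _; rewrite mulr_ge0 ?expR_ge0// ltW.
Qed.

Lemma partition_fun0 : partition_fun T x q 0 = 1.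
Proof.
by rewrite -q1; apply: eq_bigr => i _; rewrite dotv0l expR0 mulr1.
Qed.

Lemma partition_fun_sub c l :
  partition_fun (fun y => T y - c) x q l =
  expR (- dotv l c) * partition_fun T x q l.
Proof.
rewrite /partition_fun mulr_sumr; apply: eq_bigr => i _.
by rewrite dotvBr expRD; ring.
Qed.

(** Recentring the statistic absorbs the linear term of the dual objective, so
    that its maximizer becomes a minimizer of a convex function equal to 1 at
    the origin. *)
Lemma dual_objectiveE c l :
  dual_objective T c x q l = - ln (partition_fun (fun y => T y - c) x q l).
Proof.
rewrite partition_fun_sub lnM ?posrE ?expR_gt0 ?partition_fun_gt0//.
by rewrite expRK /dual_objective; ring.
Qed.

(** By convexity, the sublevel set of level 1 is star-shaped around 0. *)
Lemma partition_fun_scale a l : 0 <= a <= 1 -> partition_fun T x q l <= 1 ->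
  partition_fun T x q (a *: l) <= 1.
Proof.
move=> /andP[a0 a1] Z1.
apply: (@le_trans _ _ (\sum_i ((1 - a) * q i +
    a * (q i * expR (dotv l (T (x i))))))).
  apply: ler_sum => i _; rewrite dotvZl; set s := dotv l _.
  suff : expR (a * s) <= 1 - a + a * expR s by have := q0 i; nra.
  (* average the tangent line at a * s, taken at s and at 0 *)
  have h1 : expR (a * s) * (1 + (1 - a) * s) <= expR s.
    have -> : expR s = expR (a * s) * expR ((1 - a) * s).
      by rewrite -expRD; congr expR; ring.
    by rewrite ler_pM2l ?expR_gt0// expR_ge1Dx.
  have h2 : expR (a * s) * (1 - a * s) <= 1.
    rewrite -[leRHS](_ : expR (a * s) * expR (- (a * s)) = 1).
      by rewrite ler_pM2l ?expR_gt0// expR_ge1Dx.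
    by rewrite -expRD subrr expR0.
  have {}h1 := ler_wpM2l a0 h1.
  have b0 : 0 <= 1 - a by lra.
  have {}h2 := ler_wpM2l b0 h2.
  lra.
rewrite big_split/= -!mulr_sumr q1 -/(partition_fun T x q l).
by have := ler_wpM2l a0 Z1; lra.
Qed.

Lemma continuous_partition_fun : continuous (partition_fun T x q).
Proof.
apply: continuous_sum => i l.
apply: (@continuousM _ _ (fun=> q i) (fun u => expR (dotv u (T (x i))))).
  exact: cst_continuous.
apply: (@continuous_comp _ _ _ (fun u => dotv u (T (x i))) expR); last first.
  exact: continuous_expR.
exact: continuous_dotvl.
Qed.

End partition.

(** If [1 < Z] on the unit sphere, then by star-shapedness [1 < Z] also
    outside the ball, whereas [Z 0 = 1]: the minimum of [Z] over the compact
    ball is global.  Thus the maximizer of the dual objective exists, and it is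
    bounded by 1. *)
Lemma dual_maximizer_small (R : realType) (K L n : nat)
    (T : 'rV[R]_K -> 'rV[R]_L) (c : 'rV[R]_L) (x : 'I_n -> 'rV[R]_K)
    (q : 'I_n -> R) (Z := partition_fun (fun y => T y - c) x q) :
  (forall i, 0 < q i) -> \sum_i q i = 1 ->
  (forall u, `|u| = 1 -> 1 < Z u) ->
  Z (dual_maximizer T c x q) <= 1 /\ `|dual_maximizer T c x q| < 1.
Proof.
move=> q0 q1 Z1.
have small l : Z l <= 1 -> `|l| < 1.
  move=> Zl; rewrite ltNge; apply/negP => l1.
  have l0 : 0 < `|l| by rewrite (lt_le_trans _ l1).
  have : Z (`|l|^-1 *: l) <= 1.
    apply: partition_fun_scale => //.
    by rewrite invr_ge0 ltW//= invf_le1.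
  rewrite leNgt Z1// normrZ ger0_norm ?invr_ge0 1?ltW// mulVf// gt_eqF//.
have Z0 : Z 0 = 1 by exact: partition_fun0.
have [l0 l0B lmin] : exists2 l, l \in [set u : 'rV[R]_L | `|u| <= 1] &
    forall u, u \in [set u : 'rV[R]_L | `|u| <= 1] -> Z l <= Z u.
  apply: EVT_min_rV; first by exists 0 => /=; rewrite normr0.
    exact: closed_unit_ball_compact.
  by apply: continuous_subspaceT; exact: continuous_partition_fun.
have Zmin u : Z l0 <= Z u.
  have [uB|uB] := leP `|u| 1; first by apply: lmin; rewrite inE.
  apply: (@le_trans _ _ 1).
    by rewrite -Z0; apply: lmin; rewrite inE/= normr0.
  by rewrite leNgt; apply/negP => /ltW/small; rewrite ltNge (ltW uB).
have objP u v : (dual_objective T c x q u <= dual_objective T c x q v) =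
    (Z v <= Z u).
  by rewrite !dual_objectiveE// lerN2 ler_ln// posrE partition_fun_gt0.
have : [set l | forall l',
    dual_objective T c x q l' <= dual_objective T c x q l]
    (dual_maximizer T c x q).
  by apply: (@getPex _ _ (ex_intro _ l0 _)) => u; rewrite objP.
move=> /(_ 0); rewrite objP Z0 => Zd; split=> //; exact: small.
Qed.

Lemma maxent_weightE (R : realType) (K L n : nat) (T : 'rV[R]_K -> 'rV[R]_L)
    (c : 'rV[R]_L) (x : 'I_n -> 'rV[R]_K) (q : 'I_n -> R)
    (l := dual_maximizer T c x q)
    (Z := partition_fun (fun y => T y - c) x q l) i :
  (forall i, 0 < q i) -> \sum_i q i = 1 ->
  maxent_weight T c x q i = q i * expR (dotv l (T (x i) - c) - ln Z).
Proof.
move=> q0 q1; have Z0 : 0 < Z by exact: partition_fun_gt0.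
rewrite expRD expRN lnK// /maxent_weight -/l /Z partition_fun_sub.
rewrite dotvBr expRD; field.
by rewrite !gt_eqF ?expR_gt0 ?partition_fun_gt0.
Qed.

(** The relative entropy of [q] with respect to the maximum entropy weights is
    [ln (Z l) - <l, v>], where [v] is the deviation of the [q]-mean of [T] from
    [c]; since [Z l <= 1] and [l] lies in the unit ball, it is at most
    [L%:R * `|v|]. *)
Lemma maxent_weight_l1 (R : realType) (K L n : nat) (T : 'rV[R]_K -> 'rV[R]_L)
    (c : 'rV[R]_L) (x : 'I_n -> 'rV[R]_K) (q : 'I_n -> R) (a : R) :
  (forall i, 0 < q i) -> \sum_i q i = 1 ->
  (forall u, `|u| = 1 -> 1 < partition_fun (fun y => T y - c) x q u) ->
  0 < a -> L%:R * `|\sum_i q i *: (T (x i) - c)| <= a ^+ 2 ->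
  \sum_i `|maxent_weight T c x q i - q i| <= 2 * a.
Proof.
move=> q0 q1 Z1 a0 va.
have [] := dual_maximizer_small q0 q1 Z1.
set l := dual_maximizer _ _ _ _; set Z := partition_fun _ _ _ _ => Zle l1.
have Zgt0 : 0 < Z by exact: partition_fun_gt0.
pose t i := dotv l (T (x i) - c) - ln Z.
rewrite (eq_bigr (fun i => q i * `|expR (t i) - 1|)); last first.
  move=> i _; rewrite maxent_weightE// -/l -/Z -/(t i).
  by rewrite -[X in _ - X]mulr1 -mulrBr normrM gtr0_norm.
apply: tilt_l1_le => //; first by move=> i; exact: ltW.
  rewrite (eq_bigr (fun i => q i * expR (dotv l (T (x i) - c)) / Z)).
    by rewrite -mulr_suml divff// gt_eqF.
  by move=> i _; rewrite expRD expRN lnK// mulrA.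
have -> : \sum_i q i * t i = dotv l (\sum_i q i *: (T (x i) - c)) - ln Z.
  rewrite dotv_sumr -[ln Z]mul1r -q1 mulr_suml -sumrB.
  by apply: eq_bigr => i _; rewrite mulrBr.
apply: le_trans va.
have lnZ : ln Z <= 0 by rewrite ln_le0.
rewrite opprB; apply: (@le_trans _ _ (- dotv l (\sum_i q i *: (T (x i) - c)))).
  by rewrite gerDr.
rewrite (le_trans (ler_norm _))// normrN (le_trans (norm_dotv_le _ _))//.
by rewrite ler_wpM2r// ler_piMr// ltW.
Qed.

(** * Coercivity from weak convergence and affine independence *)

(** [h] is at least [h x0 / 2] on a neighborhood of [x0], which has positive
    mass.  Boundedness of [h] is what makes the real-valued integral
    meaningful: an infinite integral would be truncated to 0. *)
Lemma density_mean_gt0 (R : realType) K (f h : 'rV[R]_K -> R) x0 :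
  probability_density f -> continuous h -> bounded_fun h ->
  (forall y, 0 <= h y) -> support_of (density_measure f) x0 -> 0 < h x0 ->
  0 < density_mean f h.
Proof.
move=> [mf f0 f1] ch bh h0 x0f hx0.
have open_meas (U : set 'rV[R]_K) : open U -> measurable U.
  by move=> oU; rewrite measurable_rV_borel; exact: sub_sigma_algebra.
have mh : measurable_fun setT h.
  apply: (measurability _ (RGenOpens.measurableE R)).
  move=> _ [_ [a [b ->]] <-]; rewrite setTI; apply: open_meas.
  by apply: open_comp => // y _; exact: ch.
have mfE : measurable_fun setT (EFin \o f) by exact/measurable_EFinP.
have intf : (lebesgue_rV R K).-integrable setT (EFin \o f).
  apply/integrableP; split => //.
  under eq_integral => y _ do rewrite /= ger0_norm//.
  by rewrite f1 ltry.
have intfh : (lebesgue_rV R K).-integrable setT (fun y => (f y * h y)%:E).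
  under eq_fun do rewrite EFinM.
  exact: integrableMl.
set c := h x0 / 2; have c0 : 0 < c by rewrite divr_gt0.
pose U := [set y | c < h y].
have oU : open U.
  rewrite (_ : U = h @^-1` [set r | c < r])//.
  by apply: open_comp; [move=> y _; exact: ch|exact: open_gt].
have Upos : (0 < density_measure f U)%E.
  by apply: x0f => //; rewrite /U/= /c; lra.
apply: fine_gt0; rewrite ltey_eq integrable_fin_num// andbT.
apply: (@lt_le_trans _ _ (c%:E * density_measure f U)%E).
  by rewrite mule_gt0// lte_fin.
rewrite /density_measure -ge0_integralZl//=; last 4 first.
- exact: open_meas.
- exact: measurable_funS mfE.
- by move=> y _; rewrite lee_fin.
- by rewrite lee_fin ltW.
apply: (@le_trans _ _ (\int[lebesgue_rV R K]_(y in U) (f y * h y)%:E)%E).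
  apply: ge0_le_integral => //=.
  - exact: open_meas.
  - by move=> y _; rewrite lee_fin mulr_ge0// ltW.
  - exact: measurable_funS (measurable_funeM c%:E mfE).
  - exact: measurable_funS (measurable_int _ intfh).
  - by move=> y Uy; rewrite -EFinM lee_fin mulrC ler_wpM2l// ltW.
apply: ge0_subset_integral => //=.
- exact: open_meas.
- exact: measurable_int intfh.
- by move=> y _; rewrite lee_fin mulr_ge0.
Qed.

(** The bound is proved for directions close to a given [u0] on the sphere, and
    compactness does the rest.  Because [S] need not be bounded, the test
    function for weak convergence is not built from [<u0, S>] but is a bump
    [h] in the values of [S], localized where [<u, S>] is away from 0 for every
    [u] close to [u0]. *)
Lemma partition_fun_gt1_on_sphere (R : realType) (K L : nat)
    (f : 'rV[R]_K -> R) (S : 'rV[R]_K -> 'rV[R]_L)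
    (I : nat -> nat) (x : forall M, 'I_(I M) -> 'rV[R]_K)
    (q : forall M, 'I_(I M) -> R) :
  probability_density f -> continuous S ->
  (forall M, (0 < M)%N -> forall i, 0 < @q M i) ->
  (forall M, (0 < M)%N -> \sum_(i < I M) @q M i = 1) ->
  (forall u, u != 0 ->
     exists2 y, support_of (density_measure f) y & dotv u (S y) != 0) ->
  (forall h : 'rV[R]_K -> R, continuous h -> bounded_fun h ->
     \sum_(i < I M) @q M i * h (x M i) @[M --> \oo] --> density_mean f h) ->
  \sum_(i < I M) @q M i *: S (x M i) @[M --> \oo] --> (0 : 'rV[R]_L) ->
  \forall M \near \oo, forall u, `|u| = 1 ->
    1 < partition_fun S (@x M) (@q M) u.
Proof.
move=> fd cS q0 q1 Sind qw qm.
have := @unit_sphere_compact R L.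
move=> /compact_near_coveringP/near_covering_withinP.
move=> /(_ _ \oo (fun M u => 1 < partition_fun S (@x M) (@q M) u)).
apply => u0 /= u01.
have [x0 x0f s0] : exists2 y, support_of (density_measure f) y &
    dotv u0 (S y) != 0.
  by apply: Sind; rewrite -normr_eq0 u01 oner_eq0.
pose phi (s : R) := expR s - (1 + s).
have phi_ge0 s : 0 <= phi s by rewrite subr_ge0 expR_ge1Dx.
have phi_gt0 : 0 < phi (dotv u0 (S x0)) by rewrite subr_gt0 expR_gt1Dx.
set s := dotv u0 _ in s0 phi_gt0.
pose d := phi s / 2.
have d0 : 0 < d by rewrite divr_gt0.
have cphi : continuous phi.
  move=> r; apply: continuousB; first exact: continuous_expR.
  by apply: continuousD; [exact: cst_continuous|exact: cvg_id].
have [r r0 rP] : exists2 r, 0 < r & forall u v, `|u0 - u| < r ->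
    `|S x0 - v| < r -> d < phi (dotv u v).
  have cF : (fun p : 'rV[R]_L * 'rV[R]_L => phi (dotv p.1 p.2))
      @ (u0, S x0) --> phi s.
    by apply: (continuous_comp (@continuous_dotv _ _ _)); exact: cphi.
  have /(cvgr_gt _ cF) : d < phi s by rewrite /d; lra.
  move=> /nbhs_ballP[r r0 rP]; exists r => // u v u0u v0v.
  by apply: (rP (u, v)); split; rewrite -ball_normE.
pose h y := Num.max 0 (1 - `|S x0 - S y| / r).
have ch : continuous h.
  move=> y.
  apply: (@continuous_max _ _ (fun=> 0) (fun y => 1 - `|S x0 - S y| / r)).
    exact: cst_continuous.
  apply: continuousB; first exact: cst_continuous.
  apply: continuousM; last exact: cst_continuous.
  apply: (@continuous_comp _ _ _ (fun y => S x0 - S y) Num.norm).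
    by apply: continuousB; [exact: cst_continuous|exact: cS].
  exact: norm_continuous.
have h0 y : 0 <= h y by rewrite le_max lexx.
have h1 y : h y <= 1.
  by rewrite ge_max ler01 gerBl divr_ge0// ltW.
have bh : bounded_fun h.
  exists 1; split => // m m1 y _ /=.
  by rewrite ger0_norm// (le_trans (h1 y))// ltW.
have hphi u y : `|u0 - u| < r -> d * h y <= phi (dotv u (S y)).
  move=> u0u; have [yr|yr] := ltP `|S x0 - S y| r.
    by rewrite (le_trans _ (ltW (rP _ _ u0u yr)))// ger_pMr.
  rewrite (_ : h y = 0) ?mulr0//; apply/max_idPl.
  by rewrite subr_le0 ler_pdivlMr// mul1r.
have mh : 0 < density_mean f h.
  apply: (density_mean_gt0 fd ch bh h0 x0f).
  by rewrite /h subrr normr0 mul0r subr0 lt_max ltr01 orbT.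
set m := density_mean f h in mh.
(* how small the mean of S must be for its inner product with a unit vector
   not to offset the gain d * (m / 2) *)
pose e := d * (m / 2) / L.+1%:R.
have e0 : 0 < e by rewrite divr_gt0// mulr_gt0// divr_gt0.
have near_u : \forall u \near u0, `|u0 - u| < r.
  by apply/nbhs_ballP; exists r => // u; rewrite -ball_normE.
have near_h : \forall M \near \oo, m / 2 < \sum_(i < I M) @q M i * h (x M i).
  by apply: (cvgr_gt _ (qw h ch bh)); rewrite -/m; lra.
have near_S : \forall M \near \oo, `|\sum_(i < I M) @q M i *: S (x M i)| < e.
  exact: (cvgr0_norm_lt _ qm).
near=> u M => u1.
have M0 : (0 < M)%N by near: M; exact: nbhs_infty_gt.
have : `|\sum_(i < I M) @q M i *: S (x M i)| < e by near: M.
set v := \sum_(i < I M) @q M i *: S (x M i) => ve.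
have Zsplit : partition_fun S (@x M) (@q M) u =
    1 + dotv u v + \sum_(i < I M) @q M i * phi (dotv u (S (x M i))).
  rewrite dotv_sumr -(q1 M M0) -!big_split/=; apply: eq_bigr => i _.
  by rewrite /phi; ring.
have low : d * (m / 2) < \sum_(i < I M) @q M i * phi (dotv u (S (x M i))).
  apply: (@lt_le_trans _ _ (d * \sum_(i < I M) @q M i * h (x M i))).
    by rewrite ltr_pM2l//; near: M.
  rewrite mulr_sumr; apply: ler_sum => i _.
  by rewrite mulrCA ler_pM2l ?q0// hphi//; near: u.
have small : `|dotv u v| <= d * (m / 2).
  rewrite (le_trans (norm_dotv_le _ _))// u1 mulr1.
  apply: (@le_trans _ _ (L.+1%:R * e)); last by rewrite /e mulrC divfK.
  by rewrite ler_pM ?ler_nat// ltW.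
rewrite Zsplit; move: small; rewrite ler_norml => /andP[]; lra.
Unshelve. all: by end_near.
Qed.

(** * Weak convergence of the maximum entropy distributions *)

Theorem theorem5 (R : realType) (K L : nat)
    (f : 'rV[R]_K -> R) (T : 'rV[R]_K -> 'rV[R]_L)
    (I : nat -> nat) (x : forall M : nat, 'I_(I M) -> 'rV[R]_K)
    (q : forall M : nat, 'I_(I M) -> R)
    (f_density : probability_density f)
    (T_cont : continuous T)
    (T_moment : finite_moment f T)
    (x_inj : forall M, (0 < M)%N -> injective (@x M))
    (q_pos : forall M, (0 < M)%N -> forall i, 0 < @q M i)
    (q_sum1 : forall M, (0 < M)%N -> \sum_(i < I M) @q M i = 1)
    (T_indep : affine_independent_on T (support_of (density_measure f)))
    (T_interior : forall M, (0 < M)%N ->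
       (convex_hull (T @` range (@x M)))° (moment f T))
    (q_weak : forall h : 'rV[R]_K -> R, continuous h -> bounded_fun h ->
       \sum_(i < I M) @q M i * h (x M i) @[M --> \oo] --> density_mean f h)
    (q_moment :
       \sum_(i < I M) @q M i *: T (x M i) @[M --> \oo] --> moment f T)
    (g : 'rV[R]_K -> R) (g_cont : continuous g) (g_bounded : bounded_fun g) :
  \sum_(i < I M) maxent_weight T (moment f T) (@x M) (@q M) i * g (x M i)
    @[M --> \oo] --> density_mean f g.
Proof.
set c := moment f T in T_interior q_moment *.
have cS : continuous (fun y => T y - c).
  by move=> y; apply: continuousB; [exact: T_cont|exact: cst_continuous].
have qS : \sum_(i < I M) @q M i *: (T (x M i) - c) @[M --> \oo]
    --> (0 : 'rV[R]_L).
  apply/cvgr0Pnorm_lt => e e0.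
  have qe : \forall M \near \oo,
      `|c - \sum_(i < I M) @q M i *: T (x M i)| < e.
    exact: (cvgr_dist_lt _ _ q_moment).
  near=> M.
  have M0 : (0 < M)%N by near: M; exact: nbhs_infty_gt.
  under eq_bigr do rewrite scalerBr.
  by rewrite sumrB -scaler_suml q_sum1// scale1r distrC; near: M.
have Sind u : u != 0 ->
    exists2 y, support_of (density_measure f) y & dotv u (T y - c) != 0.
  move=> u0; have [|y yf /eqP uy] := T_indep u (- dotv u c).
    by move=> [/eqP]; rewrite (negbTE u0).
  by exists y => //; rewrite dotvBr.
have Z1 := partition_fun_gt1_on_sphere f_density cS q_pos q_sum1 Sind q_weak qS.
have [B B0 gB] : exists2 B, 0 < B & forall y, `|g y| <= B.
  have [B [_ gB]] := g_bounded; exists (`|B| + 1); first by rewrite ltr_wpDl.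
  by move=> y; apply: gB => //; rewrite ltr_pwDr// ler_norm.
rewrite -[density_mean f g]addr0.
pose p M i := maxent_weight T c (@x M) (@q M) i.
suff D0 : \sum_(i < I M) (p M i - @q M i) * g (x M i) @[M --> \oo] --> (0 : R).
  apply: cvg_trans (cvgD (q_weak g g_cont g_bounded) D0).
  apply: near_eq_cvg; near=> M; rewrite fctE -big_split/=.
  by apply: eq_bigr => i _; rewrite -mulrDl addrC subrK.
apply/cvgr0Pnorm_lt => e e0.
(* with total variation at most 2 * a, the error is at most 2 * a * B = e / 2 *)
pose a := e / (4 * B).
have a0 : 0 < a by rewrite divr_gt0// mulr_gt0.
have near_S : \forall M \near \oo,
    `|\sum_(i < I M) @q M i *: (T (x M i) - c)| < a ^+ 2 / L.+1%:R.
  by apply: (cvgr0_norm_lt _ qS); rewrite divr_gt0// exprn_gt0.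
near=> M.
have M0 : (0 < M)%N by near: M; exact: nbhs_infty_gt.
have pq : \sum_(i < I M) `|p M i - @q M i| <= 2 * a.
  apply: maxent_weight_l1 => //; [exact: q_pos|exact: q_sum1|by near: M|].
  apply: (@le_trans _ _ (L.+1%:R * (a ^+ 2 / L.+1%:R))); last first.
    by rewrite mulrC divfK.
  by rewrite ler_pM ?ler_nat// ltW//; near: M.
rewrite (le_lt_trans (ler_norm_sum _ _ _))//.
apply: (@le_lt_trans _ _ (2 * a * B)).
  apply: le_trans (ler_wpM2r (ltW B0) pq); rewrite mulr_suml.
  by apply: ler_sum => i _; rewrite normrM ler_wpM2l.
rewrite (_ : 2 * a * B = e / 2); first by lra.
by rewrite /a; field; rewrite gt_eqF.
Unshelve. all: by end_near.
Qed.
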